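(* If $1\le p<\infty$, then $D(\ell_p)\le 1^+$.
   Context: A metric space is locally finite if each ball of finite radius in it has finite cardinality. For $1\le C<\infty$, a map $f:(A,d_A)\to(Y,d_Y)$ between metric spaces is a $C$-bilipschitz embedding if there exists $r>0$ such that $r\,d_A(u,v)\le d_Y(f(u),f(v))\le rC\,d_A(u,v)$ for all $u,v\in A$. A bilipschitz embedding is a map that is $C$-bilipschitz for some such $C$. The distortion of $f$ is the smallest $C$ for which such an $r$ exists. For a Banach space $X$ and a real number $\alpha\ge 1$: (1) $D(X)\le\alpha$ means that, for every $C\in[1,\infty)$ and every locally finite metric space $A$ all of whose finite subsets admit bilipschitz embeddings into $X$ with distortions $\le C$, the space $A$ itself admits a bilipschitz embedding into $X$ with distortion $\le\alpha\cdot C$. (2) $D(X)=\alpha^+$ means that $D(X)\le\alpha+\varepsilon$ holds for every $\varepsilon>0$, while $D(X)\le\alpha$ does not hold. (3) $D(X)\le\alpha^+$ means that $D(X)=\alpha^+$ or $D(X)\le\alpha$ (equivalently, $D(X)\le\alpha+\varepsilon$ for every $\varepsilon>0$). *)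

(* Defs.v *)
From HB Require Import structures.
From mathcomp Require Import all_boot all_order all_algebra.
From mathcomp Require Import all_classical all_reals all_analysis.

Set Implicit Arguments.
Unset Strict Implicit.
Unset Printing Implicit Defensive.

Import Order.TTheory GRing.Theory Num.Theory.
Import numFieldNormedType.Exports.

Local Open Scope classical_set_scope.
Local Open Scope ring_scope.

Definition lp_sum (R : realType) (p : R) (x : nat -> R) : \bar R :=
  (\sum_(0 <= k <oo) (`|x k| `^ p)%:E)%E.

(* Summability of |x_k|^p; note that [0 `^ p = 0] since [p != 0]. *)
Definition lp_pred (R : realType) (p : R) : {pred nat -> R} :=
  [pred x | (lp_sum p x < +oo)%E].

Record lp (R : realType) (p : R) (p1 : 1 <= p) : Type :=
  Lp { lp_val :> nat -> R ; lp_valP : lp_val \in lp_pred p }.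

(* Locked, as unification tends to unfold the series and the power. *)
HB.lock Definition lp_norm (R : realType) (p : R) (p1 : 1 <= p)
    (x : lp p1) : R :=
  fine (lp_sum p x) `^ p^-1.
Canonical locked_lp_norm := Unlockable lp_norm.unlock.

Section lp_normed.
Context (R : realType) (p : R) (p1 : 1 <= p).
Local Notation X := (lp p1).

Let p0 : 0 < p. Proof. exact: lt_le_trans p1. Qed.
Let pN0 : p != 0. Proof. by rewrite gt_eqF. Qed.
Let ip0 : 0 < p^-1. Proof. by rewrite invr_gt0. Qed.

Let N (x : nat -> R) : \bar R := (lp_sum p x `^ p^-1)%E.

Let lp_sum_ge0 x : (0 <= lp_sum p x)%E.
Proof. by apply: nneseries_ge0 => k _ _; rewrite lee_fin powR_ge0. Qed.

Let N_ge0 x : (0 <= N x)%E. Proof. exact: poweR_ge0. Qed.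

Let N_Lnorm x : N x = ('N[@counting nat R]_p%:E[EFin \o x])%E.
Proof. by rewrite Lnorm_counting. Qed.

Let N_fin x : (N x < +oo)%E = (x \in lp_pred p).
Proof.
rewrite inE; apply/idP/idP; first by apply: lty_poweRy; rewrite gt_eqF.
exact: poweR_lty.
Qed.

Let N_le (x : nat -> R) (e : R) : 0 <= e ->
  (forall n, \sum_(k < n) `|x k| `^ p <= e `^ p) ->
  (N x <= e%:E)%E.
Proof.
move=> e0 xe.
have -> : e%:E = ((e `^ p)%:E `^ p^-1)%E.
  by rewrite poweR_EFin -powRrM mulfV// powRr1.
apply: gt0_ler_poweR; first exact: ltW.
- by rewrite in_itv/= lp_sum_ge0 leey.
- by rewrite in_itv/= lee_fin powR_ge0 leey.
apply: lime_le.
  by apply: is_cvg_nneseries => k _ _; rewrite lee_fin powR_ge0.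
by apply: nearW => n; rewrite sumEFin big_mkord lee_fin.
Qed.

Let N_sum_le (x : nat -> R) (e : R) n : 0 <= e -> (N x <= e%:E)%E ->
  \sum_(k < n) `|x k| `^ p <= e `^ p.
Proof.
move=> e0 xe.
have h : (N x `^ p <= e%:E `^ p)%E.
  apply: gt0_ler_poweR xe; first exact: ltW.
  - by rewrite in_itv/= N_ge0 leey.
  - by rewrite in_itv/= lee_fin e0 leey.
move: h; rewrite /N -poweRrM mulVf// poweRe1// poweR_EFin => h.
rewrite -lee_fin; apply: le_trans h.
rewrite -sumEFin -(big_mkord xpredT (fun k => (`|x k| `^ p)%:E)).
by apply: nneseries_lim_ge => k _ _; rewrite lee_fin powR_ge0.
Qed.

Let ND (x y : nat -> R) : (N (x + y)%R <= N x + N y)%E.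
Proof. by rewrite !N_Lnorm; exact: minkowski_EFin. Qed.

Let NZ (a : R) (x : nat -> R) : N (a *: x) = (`|a|%:E * N x)%E.
Proof.
rewrite /N; have -> : lp_sum p (a *: x) = ((`|a| `^ p)%:E * lp_sum p x)%E.
  rewrite -nneseriesZl.
    apply: eq_eseriesr => k _.
    by rewrite -EFinM -powRM// -normrM.
  by move=> k _; rewrite lee_fin powR_ge0.
by rewrite poweRM ?lee_fin ?powR_ge0// poweR_EFin -powRrM mulfV// powRr1.
Qed.

Let N0 : N 0 = 0%E.
Proof. by have := NZ 0 0; rewrite scale0r normr0 mul0e. Qed.

Fact lp_submod_closed : submod_closed (@lp_pred R p).
Proof.
split; first by rewrite -N_fin N0 ltry.
move=> a x y; rewrite -!N_fin => xp yp.
by rewrite (le_lt_trans (ND _ _))// NZ lte_add_pinfty// lte_mul_pinfty.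
Qed.

HB.instance Definition _ := [isSub for @lp_val R p p1].
HB.instance Definition _ := [Choice of X by <:].
HB.instance Definition _ :=
  GRing.SubChoice_isSubLmodule.Build R (nat -> R) (@lp_pred R p) X
    lp_submod_closed.

Fact lp_valD (x y : X) : (x + y : X) = (x : nat -> R) + y :> (nat -> R).
Proof. exact: (raddfD (val : X -> nat -> R)). Qed.

Fact lp_valZ (a : R) (x : X) : (a *: x : X) = a *: (x : nat -> R) :> (nat -> R).
Proof. exact: (linearZZ (val : X -> nat -> R)). Qed.

Let lp_normE (x : X) : (lp_norm x)%:E = N x.
Proof.
have xfin : (N x < +oo)%E by rewrite N_fin; exact: lp_valP.
by rewrite unlock -fine_poweR fineK// (ge0_fin_numE (N_ge0 x)).
Qed.

Fact lp_norm_triangle (x y : X) : lp_norm (x + y) <= lp_norm x + lp_norm y.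
Proof. by rewrite -lee_fin EFinD !lp_normE lp_valD; exact: ND. Qed.

Fact lp_normZ (a : R) (x : X) : lp_norm (a *: x) = `|a| * lp_norm x.
Proof. by apply: EFin_inj; rewrite EFinM !lp_normE lp_valZ; exact: NZ. Qed.

Let coord_le (x : X) k : `|x k| <= lp_norm x.
Proof.
have nx0 : 0 <= lp_norm x by rewrite unlock; exact: powR_ge0.
have := @N_sum_le x (lp_norm x) k.+1 nx0; rewrite lp_normE => /(_ (lexx _)).
rewrite big_ord_recr/= => h.
have {h} : `|x k| `^ p <= lp_norm x `^ p.
  by apply: le_trans h; rewrite lerDr sumr_ge0// => i _; rewrite powR_ge0.
by apply: contraTT; rewrite -!ltNge => ?; rewrite gt0_ltr_powR.
Qed.

Fact lp_norm_eq0 (x : X) : lp_norm x = 0 -> x = 0.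
Proof.
move=> x0; apply: val_inj; apply/funext => k /=.
by apply/eqP; rewrite -normr_le0 -x0 coord_le.
Qed.

HB.instance Definition _ :=
  Lmodule_isNormed.Build R X lp_norm_triangle lp_normZ lp_norm_eq0.

Let powR_norm_continuous : continuous (fun t : R => `|t| `^ p).
Proof.
move=> t; have [->|tN0] := eqVneq t 0.
  apply/cvgrPdist_lt => e e0; near=> y.
  rewrite normr0 powR0// sub0r normrN ger0_norm ?powR_ge0//.
  have -> : e = (e `^ p^-1) `^ p by rewrite -powRrM mulVf// powRr1// ltW.
  rewrite gt0_ltr_powR ?nnegrE ?powR_ge0//.
  near: y; apply: (@pseudometric_normed_Zmodule.nbhs0_lt R R).
  exact: powR_gt0.
apply: (@cvg_trans _ ((fun y => expR (p * ln `|y|)) @ t)).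
  apply: near_eq_cvg; near=> y.
  rewrite /powR normr_eq0 ifF//; apply/negbTE.
  near: y; exact: open_neq.
rewrite /powR normr_eq0 (negbTE tN0).
have lnt : (fun y : R => ln `|y|) @ t --> ln `|t|.
  apply: (@continuous_cvg _ _ _ (nbhs t) _ (fun y : R => `|y|) (@ln R)).
    by apply: continuous_ln; rewrite normr_gt0.
  exact: norm_continuous.
apply: (@continuous_cvg _ _ _ (nbhs t) _ (fun y : R => p * ln `|y|) expR).
  exact: continuous_expR.
exact: cvgMl_tmp lnt.
Unshelve. all: by end_near. Qed.

Let lp_valB (x y : X) k : (x - y : X) k = x k - y k.
Proof. by rewrite lp_valD -scaleN1r lp_valZ scaleN1r. Qed.

Let lp_cauchy_cvg (F : set_system X) :
  ProperFilter F -> cauchy F -> cvg F.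
Proof.
move=> FF /cauchy_ballP Fc.
have Fc1 (e : R) : 0 < e ->
    \forall h \near F, \forall x \near F, lp_norm (x - h) < e.
  move=> e0; have /nearP_dep := Fc e e0.
  by apply: filterS => h; apply: filterS => x; rewrite -ball_normE/= distrC.
have cvgk k : cvg ((fun x : X => x k) @ F).
  apply: R_complete; apply/cauchy_exP => e e0.
  near F => h; exists (h k).
  suff : F [set x : X | ball (h k) e (x k)] by [].
  near=> x; rewrite -ball_normE/= distrC -lp_valB.
  apply: (le_lt_trans (coord_le _ _)).
  by near: x; near: h; exact: Fc1.
pose g (k : nat) : R := lim ((fun x : X => x k) @ F).
have gh (e : R) : 0 < e ->
    F [set h : X | (N (g - (h : nat -> R))%R <= e%:E)%E].
  move=> e0; near=> h; apply: N_le => [|n]; first exact: ltW.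
  have sumF : (fun x : X => \sum_(k < n) `|x k - h k| `^ p) @ F -->
      \sum_(k < n) `|g k - h k| `^ p.
    apply: cvg_big => [|k _]; first exact: add_continuous.
    apply: (@continuous_cvg _ _ _ F _ (fun x : X => x k - h k)
      (fun t : R => `|t| `^ p)); first exact: powR_norm_continuous.
    by apply: cvgB; [exact: cvgk|exact: cvg_cst].
  apply: (cvgr_to_le sumF).
  near=> x; have : lp_norm (x - h) <= e.
    by apply/ltW; near: x; near: h; exact: Fc1.
  rewrite -lee_fin lp_normE => /(N_sum_le n (ltW e0)).
  by under eq_bigr do rewrite lp_valB.
have gp : g \in lp_pred p.
  near F => h; rewrite -N_fin -[g](subrK (h : nat -> R)).
  rewrite (le_lt_trans (ND _ _))// lte_add_pinfty//.
    apply: (@le_lt_trans _ _ 1%:E); last exact: ltry.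
    by near: h; exact: gh.
  by rewrite N_fin; exact: lp_valP.
apply/cvg_ex; exists (Lp p1 gp); apply/cvgrPdist_le => e e0.
near=> h; rewrite -lee_fin [leLHS]lp_normE.
have -> : (Lp p1 gp - h : X) = (g - (h : nat -> R)) :> (nat -> R).
  by apply/funext => k; rewrite lp_valB.
by near: h; exact: gh.
Unshelve. all: by end_near. Qed.

HB.instance Definition _ := Uniform_isComplete.Build X lp_cauchy_cvg.

End lp_normed.

Lemma lp_normrE (R : realType) (p : R) (p1 : 1 <= p) (x : lp p1) :
  `|x| = fine (lp_sum p x) `^ p^-1.
Proof. by rewrite -[LHS]/(lp_norm x) unlock. Qed.

(* A subset [S] of [A] carries the induced metric; a
   map from [S] to the vector space [X] is represented by a map on [A] whose
   values outside [S] are irrelevant. *)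

Section bilipschitz.
Context (R : realType) (A : metricType R) (X : normedModType R).
Implicit Types (S : set A) (f : A -> X) (C : R).

Definition bilipschitz_on S f C : Prop :=
  1 <= C /\
  exists2 r : R, 0 < r &
    forall u v : A, S u -> S v ->
      r * mdist u v <= `|f u - f v| <= r * C * mdist u v.

(* The infimum of the admissible [C] is attained, so every bilipschitz map has
   a distortion in this sense. *)
Definition is_distortion S f C : Prop :=
  bilipschitz_on S f C /\ forall C' : R, bilipschitz_on S f C' -> C <= C'.

Definition embeds_with_distortion_le S C : Prop :=
  exists f : A -> X, exists2 D : R, is_distortion S f D & D <= C.

End bilipschitz.
Arguments embeds_with_distortion_le {R A} X S C.

Definition locally_finite_metric (R : realType) (A : metricType R) : Prop :=
  forall (x : A) (r : R), finite_set (ball x r).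

(* [D_le X alpha], [D_eq_plus X alpha] and [D_le_plus X alpha] stand for
   D(X) <= alpha, D(X) = alpha^+ and D(X) <= alpha^+; D(X) is not a number. *)

Section D_parameter.
Context (R : realType) (X : completeNormedModType R).

Definition D_le (alpha : R) : Prop :=
  forall (C : R) (A : metricType R), 1 <= C -> locally_finite_metric A ->
    (forall S : set A, finite_set S -> embeds_with_distortion_le X S C) ->
    embeds_with_distortion_le X [set: A] (alpha * C).

Definition D_eq_plus (alpha : R) : Prop :=
  (forall e : R, 0 < e -> D_le (alpha + e)) /\ ~ D_le alpha.

Definition D_le_plus (alpha : R) : Prop := D_eq_plus alpha \/ D_le alpha.

End D_parameter.

(* Main.v *)
(* Since l_p is isometric to the l_p-sum of countably many copies of itself,
   embeddings f_i of growing balls B(o, rho_i) can be glued into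
   F u = (c_i(d(o, u)) f_i(u))_i, where c is a path of unit vectors of l_p with
   c_i(t) = 0 for t >= rho_i. For d(o, v) <= d(o, u),
     F u - F v = (c_i(d(o, u)) (f_i u - f_i v))_i
               + ((c_i(d(o, u)) - c_i(d(o, v))) f_i v)_i;
   the first term has norm between d(u, v) and C d(u, v), as |c| = 1, and the
   second is at most C eps d(u, v) as soon as c moves slowly on a logarithmic
   scale: s |c(t) - c(s)| <= eps (t - s) for s <= t. *)
Require Import Defs.
From mathcomp Require Import all_boot all_order all_algebra.
From mathcomp Require Import all_classical all_reals all_analysis.
From mathcomp Require Import ring lra.
Import Order.TTheory GRing.Theory Num.Theory.
Import numFieldNormedType.Exports.
Local Open Scope ring_scope.

(** * Norm, coordinates and unit vectors of l_p *)

Lemma lp_sum_ge0 (R : realType) (p : R) (s : nat -> R) : (0 <= lp_sum p s)%E.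
Proof. exact: nneseries_ge0. Qed.

Lemma le_lp_sum (R : realType) (p : R) (s s' : nat -> R) : 0 <= p ->
  (forall k, `|s k| <= `|s' k|) -> (lp_sum p s <= lp_sum p s')%E.
Proof.
move=> p0 ss'; apply: lee_nneseries => // k _.
by rewrite lee_fin ge0_ler_powR ?nnegrE.
Qed.

Section lp_facts.
Context {R : realType} {p : R} {p1 : 1 <= p}.
Implicit Types (x y : lp p1).

Let p0 : 0 < p. Proof. exact: lt_le_trans p1. Qed.

Lemma lp_sum_norm x : lp_sum p x = (`|x| `^ p)%:E.
Proof.
have xfin : lp_sum p x \is a fin_num.
  by rewrite ge0_fin_numE ?lp_sum_ge0//; exact: lp_valP.
rewrite lp_normrE -powRrM mulVf ?gt_eqF// powRr1 ?fineK//.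
by rewrite fine_ge0 ?lp_sum_ge0.
Qed.

Lemma lp_sum_le_norm x (K : R) : 0 <= K ->
  (`|x| <= K) = (lp_sum p x <= (K `^ p)%:E)%E.
Proof.
move=> K0; rewrite lp_sum_norm lee_fin.
apply/idP/idP => [h|h]; first by rewrite ge0_ler_powR ?nnegrE// ltW.
by rewrite leNgt; apply: contraTN h => h; rewrite -ltNge gt0_ltr_powR ?nnegrE.
Qed.

Lemma le_lp_norm x y : (forall k, `|x k| <= `|y k|) -> `|x| <= `|y|.
Proof.
move=> xy; rewrite lp_sum_le_norm// -lp_sum_norm.
exact: le_lp_sum (ltW p0) xy.
Qed.

Lemma lp_coordD x y k : (x + y) k = x k + y k.
Proof. by rewrite lp_valD. Qed.

Lemma lp_coordZ a x k : (a *: x) k = a * x k.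
Proof. by rewrite lp_valZ. Qed.

Lemma lp_coordB x y k : (x - y) k = x k - y k.
Proof. by rewrite -scaleN1r lp_coordD lp_coordZ mulN1r. Qed.

Lemma lp_ext x y : (forall k, x k = y k) -> x = y.
Proof. by move=> xy; apply: val_inj; apply/funext. Qed.

Fact delta_subproof n : (fun k => (k == n)%:R : R) \in lp_pred p.
Proof.
rewrite inE /lp_sum (nneseriesD1 (n := n))//.
rewrite eseries0 => [|k _ /andP[_ /negPf ->]]; first by rewrite adde0 ltry.
by rewrite normr0 powR0 ?gt_eqF.
Qed.

Definition lp_delta n : lp p1 := Lp p1 (delta_subproof n).

Lemma norm_lp_delta n : `|lp_delta n| = 1.
Proof.
rewrite lp_normrE /lp_sum (nneseriesD1 (n := n))//.
rewrite eseries0 ?adde0 => [|k _ /andP[_ /negPf /= ->]]; last first.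
  by rewrite normr0 powR0 ?gt_eqF.
by rewrite /= eqxx normr1 !powR1.
Qed.

(** The vector [|x k| *: lp_delta k] is dominated coordinatewise by [x]. *)
Lemma lp_coord_le x k : `|x k| <= `|x|.
Proof.
rewrite -(@ger0_norm _ `|x k|)// -[X in X <= _]mulr1 -(norm_lp_delta k).
rewrite -normrZ le_lp_norm// => j.
rewrite lp_coordZ normrM normr_id.
by rewrite normr_nat; case: eqVneq => [->|_]; rewrite ?mulr1 ?mulr0.
Qed.

End lp_facts.

(** * Weighted l_p-sums of sequences of vectors, flattened into l_p *)

Section glue.
Context {R : realType} {p : R} {p1 : 1 <= p}.
Variable sigma : nat -> nat * nat.
Hypothesis sigma_bij : set_bij setT setT sigma.
Implicit Types (c : lp p1) (x : nat -> lp p1).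

Let p0 : 0 < p. Proof. exact: lt_le_trans p1. Qed.

Definition interleave (c : nat -> R) x (k : nat) : R :=
  c (sigma k).1 * x (sigma k).1 (sigma k).2.

(** Tonelli: reindexing along [sigma] gives a double series of nonnegative terms, whose inner sum
    over [j] is |c_i|^p |x_i|^p. *)
Lemma lp_sum_interleave (c : nat -> R) x :
  lp_sum p (interleave c x) = lp_sum p (fun i => c i * `|x i|).
Proof.
pose a i j : \bar R := (`|c i * x i j| `^ p)%:E.
have a0 i j : (0 <= a i j)%E by rewrite lee_fin powR_ge0.
rewrite /lp_sum nneseries_esumT//.
rewrite -(reindex_esum _ _ _ (fun ij => a ij.1 ij.2) sigma_bij).
rewrite nneseries_esumT//.
have -> : [set: (nat * nat)%type]%classic =
    ([set: nat] `*`` (fun=> [set: nat]))%classic.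
  by apply/seteqP; split.
rewrite -esum_esum//; apply: eq_esum => i _.
rewrite normrM normr_id powRM// EFinM -lp_sum_norm /lp_sum -nneseriesZl.
  rewrite -nneseries_esumT//; apply: eq_eseriesr => j _.
  by rewrite /a normrM powRM.
by move=> j _; rewrite lee_fin powR_ge0.
Qed.

(* Junk value [0] when the glued sequence is not in l_p. *)
Definition glue c x : lp p1 := insubd (0 : lp p1) (interleave c x).

Lemma interleave_lp c x (K : R) : (forall i, `|x i| <= K) ->
  interleave c x \in lp_pred p.
Proof.
move=> xK; rewrite inE lp_sum_interleave.
apply: (@le_lt_trans _ _ (lp_sum p (K *: c))); last exact: lp_valP.
apply: le_lp_sum (ltW p0) _ => i.
rewrite lp_coordZ mulrC normrM normrM normr_id.
by rewrite ler_wpM2r// (le_trans (xK i))// ler_norm.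
Qed.

Lemma glue_val c x (K : R) : (forall i, `|x i| <= K) ->
  glue c x = interleave c x :> (nat -> R).
Proof. by move=> /interleave_lp h; exact: insubdK (h c). Qed.

(** Blockwise, c_i x_i - c'_i x'_i = c_i (x_i - x'_i) + (c_i - c'_i) x'_i. The bound [K] ensures
    that no glued vector here takes the junk value. *)
Lemma glueB c c' x x' (K : R) :
  (forall i, `|x i| <= K) -> (forall i, `|x' i| <= K) ->
  glue c x - glue c' x' = glue c (fun i => x i - x' i) + glue (c - c') x'.
Proof.
move=> xK x'K; apply: lp_ext => k.
rewrite lp_coordB lp_coordD.
rewrite (glue_val _ _ _ xK) !(glue_val _ _ _ x'K) (@glue_val _ _ (K + K)).
  by rewrite /interleave !lp_coordB; ring.
by move=> i; rewrite (le_trans (ler_normB _ _))// lerD.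
Qed.

(** [B] keeps [glue] off its junk value and may be crude; [K] concerns only the blocks of nonzero
    weight, which will be those whose ball contains both points compared. *)
Lemma norm_glue_le c x (K B : R) : (forall i, `|x i| <= B) -> 0 <= K ->
  (forall i, c i != 0 -> `|x i| <= K) -> `|glue c x| <= K * `|c|.
Proof.
move=> xB K0 xK; rewrite -[X in X * _](ger0_norm K0) -normrZ.
rewrite lp_sum_le_norm// -lp_sum_norm (glue_val _ _ _ xB) lp_sum_interleave.
apply: le_lp_sum (ltW p0) _ => i.
rewrite lp_coordZ !normrM normr_id (ger0_norm K0).
rewrite mulrC; have [->|ci0] := eqVneq (c i) 0; first by rewrite normr0 !mulr0.
by rewrite ler_wpM2r// xK.
Qed.

Lemma norm_glue_ge c x (K B : R) : (forall i, `|x i| <= B) -> 0 <= K ->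
  (forall i, c i != 0 -> K <= `|x i|) -> K * `|c| <= `|glue c x|.
Proof.
move=> xB K0 xK; rewrite -[X in X * _](ger0_norm K0) -normrZ.
rewrite lp_sum_le_norm// -lp_sum_norm (glue_val _ _ _ xB) lp_sum_interleave.
apply: le_lp_sum (ltW p0) _ => i.
rewrite lp_coordZ !normrM normr_id (ger0_norm K0).
rewrite mulrC; have [->|ci0] := eqVneq (c i) 0; first by rewrite normr0 !mul0r.
by rewrite mulrC [leRHS]mulrC ler_wpM2r// xK.
Qed.

End glue.

Lemma nat_pairing : exists sigma : nat -> nat * nat, set_bij setT setT sigma.
Proof.
have /card_esym/ppcard_eqP[f] := card_nat2.
by exists f; exact: bij.
Qed.

(** * A slowly moving path of unit vectors *)

(** Split the difference as (x - y)/|x| + (1/|x| - 1/|y|) y. The second term has norm ||y| -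
    |x||/|x|, so each is at most |x - y|/|x|. *)
Lemma dist_normalize_le (R : realType) (X : normedModType R) (x y : X) :
  x != 0 -> y != 0 ->
  `| `|x|^-1 *: x - `|y|^-1 *: y | <= 2 * `|x - y| / `|x|.
Proof.
move=> x0 y0.
have nx : 0 < `|x| by rewrite normr_gt0.
have ny : 0 < `|y| by rewrite normr_gt0.
have -> : `|x|^-1 *: x - `|y|^-1 *: y =
    `|x|^-1 *: (x - y) + (`|x|^-1 - `|y|^-1) *: y.
  by rewrite scalerBr scalerBl addrA subrK.
rewrite (le_trans (ler_normD _ _))// !normrZ ger0_norm ?invr_ge0//.
have -> : `| `|x|^-1 - `|y|^-1| * `|y| = `|x|^-1 * `| `|y| - `|x| |.
  have -> : `|x|^-1 - `|y|^-1 = `|x|^-1 * `|y|^-1 * (`|y| - `|x|).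
    by field; rewrite !gt_eqF.
  rewrite !normrM !(ger0_norm (_ : 0 <= _^-1)) ?invr_ge0//.
  by field; rewrite !gt_eqF.
rewrite -mulrDr mulrC ler_wpM2r ?invr_ge0//.
by have := ler_dist_dist y x; rewrite (distrC y); lra.
Qed.

Section slow_path.
Context {R : realType} {p : R} {p1 : 1 <= p}.
Local Notation e := (@lp_delta R p p1).

Let segment n (t : R) : lp p1 := e n + t *: (e n.+1 - e n).

Let segment_lip n (t u : R) : `|segment n t - segment n u| <= 2 * `|t - u|.
Proof.
rewrite /segment opprD addrACA subrr add0r -scalerBl normrZ mulrC.
rewrite ler_wpM2r// (le_trans (ler_normB _ _))// !norm_lp_delta.
lra.
Qed.

Let polygon (s : R) : lp p1 := segment (Num.truncn s) (s - (Num.truncn s)%:R).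

Let polygon_lip (s t : R) : 0 <= s -> s <= t ->
  `|polygon t - polygon s| <= 2 * (t - s).
Proof.
move=> s0 st; have t0 := le_trans s0 st.
rewrite /polygon; have := le_truncn st.
have /andP[] := truncn_itv s0; have /andP[] := truncn_itv t0.
move: (Num.truncn s) (Num.truncn t) => n m mt tm ns sn.
rewrite leq_eqVlt => /predU1P[<-|nm].
  rewrite (le_trans (segment_lip _ _ _))// opprB addrA subrK.
  by rewrite ger0_norm// subr_ge0.
have seg1 : segment n 1 = e n.+1 by rewrite /segment scale1r subrKC.
have seg0 : segment m 0 = e m by rewrite /segment scale0r addr0.
have h1 := segment_lip n 1 (s - n%:R).
have h2 := segment_lip m (t - m%:R) 0.
(* On different edges, the path is cut at the vertices [e n.+1] and [e m]. These coincide, or else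
   their distance is at most 2 while [m - n.+1] is at least 1. *)
have h3 : `|e m - e n.+1| <= 2 * (m%:R - n.+1%:R).
  move: nm; rewrite leq_eqVlt => /predU1P[<-|nm].
    by rewrite !subrr normr0 mulr0.
  rewrite (le_trans (ler_normB _ _))// !norm_lp_delta.
  have : n.+2%:R <= m%:R :> R by rewrite ler_nat.
  by rewrite -[n.+2]addn1 natrD; lra.
rewrite -(subrKA (e m)) -(subrKA (e n.+1) (e m)) addrA.
rewrite (le_trans (ler_normD _ _))//.
rewrite seg0 subr0 in h2; rewrite seg1 in h1.
have := ler_normD (segment m (t - m%:R) - e m) (e m - e n.+1).
rewrite ger0_norm in h1; last by rewrite -natr1 in sn; lra.
rewrite ger0_norm in h2; last by lra.
move: h3 h1; rewrite -natr1; lra.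
Qed.

Let polygon_coord (s : R) i : polygon s i =
  (1 - (s - (Num.truncn s)%:R)) * (i == Num.truncn s)%:R +
  (s - (Num.truncn s)%:R) * (i == (Num.truncn s).+1)%:R.
Proof. by rewrite /polygon /segment lp_coordD lp_coordZ lp_coordB /=; ring. Qed.

(** The two coordinates 1 - t and t add up to 1, so one of them is at least 1/2. *)
Let polygon_norm (s : R) : 2^-1 <= `|polygon s|.
Proof.
have := lp_coord_le (polygon s) (Num.truncn s).
have := lp_coord_le (polygon s) (Num.truncn s).+1.
rewrite !polygon_coord !eqxx gtn_eqF// ltn_eqF// !mulr0 !mulr1 add0r addr0.
set t := s - _; have := ler_norm t; have := ler_norm (1 - t); lra.
Qed.

Let polygon_supp (s : R) i : 0 <= s -> polygon s i != 0 -> s < i.+1%:R.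
Proof.
move=> s0; have /andP[_ sn] := truncn_itv s0; rewrite polygon_coord.
case: (eqVneq i (Num.truncn s)) => [->//|_].
case: (eqVneq i (Num.truncn s).+1) => [-> _|_]; last first.
  by rewrite !mulr0 addr0 eqxx.
by rewrite (lt_le_trans sn)// ler_nat.
Qed.

(* The polygonal path through the unit vectors, normalized and run through in
   logarithmic time. *)
Lemma slow_unit_path (eps : R) : 0 < eps ->
  exists (c : R -> lp p1) (rho : nat -> R), [/\ forall i, 0 < rho i,
    forall t, `|c t| = 1,
    forall t i, 0 <= t -> c t i != 0 -> t < rho i &
    forall s t, 0 <= s -> s <= t -> s * `|c t - c s| <= eps * (t - s)].
Proof.
(* 8 = 2 * 2 * 2: the factor lost in normalizing, the Lipschitz constant of [polygon], and the bound
   2 on the inverse of its norm. *)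
move=> eps0; pose d := eps / 8%:R; have d0 : 0 < d by rewrite divr_gt0.
pose tau (t : R) := d * ln (1 + t).
have pN0 s : polygon s != 0.
  by rewrite -normr_gt0 (lt_le_trans _ (polygon_norm s))// invr_gt0.
exists (fun t => `|polygon (tau t)|^-1 *: polygon (tau t)).
(* Coordinate [i] vanishes once [tau t] reaches i + 1, that is, once 1 + t reaches this value. *)
exists (fun i => expR (i.+1%:R / d)); split.
- by move=> i; exact: expR_gt0.
- by move=> t; rewrite normrZ ger0_norm ?invr_ge0// mulVf// normr_eq0.
- move=> t i t0; rewrite lp_coordZ => h.
  have pi0 : polygon (tau t) i != 0 by apply: contra_neq h => ->; rewrite mulr0.
  have tau0 : 0 <= tau t by rewrite mulr_ge0 ?(ltW d0)// ln_ge0// lerDl.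
  have := polygon_supp _ _ tau0 pi0; rewrite /tau mulrC -ltr_pdivlMr//.
  rewrite -ltr_expR lnK ?posrE ?ltr_wpDr//; apply: le_lt_trans.
  by rewrite lerDr.
- move=> s t s0 st; have s10 : 0 < 1 + s by rewrite ltr_wpDr.
  have t10 : 0 < 1 + t by rewrite ltr_wpDr// (le_trans s0).
  have tau0 : 0 <= tau s by rewrite mulr_ge0 ?(ltW d0)// ln_ge0// lerDl.
  have tau_le : tau s <= tau t.
    by rewrite ler_wpM2l ?(ltW d0)// ler_ln ?posrE// lerD2l.
  (* From ln (1 + x) <= x at x = (t - s)/(1 + s). *)
  have tau_lip : tau t - tau s <= d * ((t - s) / (1 + s)).
    rewrite -mulrBr ler_wpM2l ?(ltW d0)// -ln_div ?posrE//.
    have -> : (1 + t) / (1 + s) = 1 + (t - s) / (1 + s).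
      by field; rewrite gt_eqF.
    rewrite le_ln1Dx// (@lt_le_trans _ _ 0)// ?ltrN10//.
    by rewrite divr_ge0 ?subr_ge0// ltW.
  have := dist_normalize_le _ _ _ _ (pN0 (tau t)) (pN0 (tau s)).
  have inv2 : `|polygon (tau t)|^-1 <= 2.
    by rewrite -[leRHS]invrK lef_pV2 ?posrE ?normr_gt0 ?invr_gt0//.
  move=> h; have {h} : `| `|polygon (tau t)|^-1 *: polygon (tau t) -
      `|polygon (tau s)|^-1 *: polygon (tau s)| <= eps * ((t - s) / (1 + s)).
    apply: (le_trans h); have pl := polygon_lip _ _ tau0 tau_le.
    apply: (@le_trans _ _ (2 * (2 * (tau t - tau s)) * 2)).
      by rewrite ler_pM ?mulr_ge0 ?invr_ge0// ler_wpM2l.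
    by move: tau_lip; rewrite /d; lra.
  move=> /(ler_wpM2l s0) /le_trans; apply.
  (* What remains is s/(1 + s) <= 1. *)
  rewrite mulrCA ler_wpM2l ?(ltW eps0)// mulrA ler_pdivrMr// mulrC.
  by rewrite ler_wpM2l ?subr_ge0// lerDr.
Qed.

End slow_path.

(** * Attained distortion and normalized embeddings *)

Section distortion.
Context {R : realType} {A : metricType R} {X : normedModType R}.
Implicit Types (S : set A) (f : A -> X) (C : R).

(** The infimum of the admissible constants is attained because one scale serves them all: [inf Q],
    the largest lower Lipschitz constant. A scale s admissible for D satisfies s <= [inf Q], so D
    remains admissible with [inf Q], and the upper estimate passes to the infimum over D. *)
Lemma bilipschitz_embeds S f C :
  bilipschitz_on S f C -> embeds_with_distortion_le X S C.
Proof.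
move=> fC; pose E := [set D | bilipschitz_on S f D]%classic.
have E_lb : lbound E 1 by move=> D [].
have hE : has_inf E by split; [exists C|exists 1].
have E1 : 1 <= inf E by apply: lb_le_inf => //; case: hE.
exists f, (inf E); last by apply: ge_inf => //; case: hE.
split=> [|D fD]; last by apply: ge_inf => //; case: hE.
split=> //.
pose Q := [set q | exists u v, [/\ S u, S v, u != v &
  q = `|f u - f v| / mdist u v]]%classic.
have [[q0 Qq0]|Q0] := pselect (Q !=set0)%classic; last first.
  (* Here [S] has no two distinct points, so any scale works. *)
  exists 1 => // u v Su Sv; have [->|uv] := eqVneq u v.
    by rewrite mdistxx subrr normr0 !mulr0 lexx.
  by exfalso; apply: Q0; exists (`|f u - f v| / mdist u v), u, v.
have lbQ D r : (forall u v, S u -> S v ->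
    r * mdist u v <= `|f u - f v| <= r * D * mdist u v) -> lbound Q r.
  move=> h _ [u [v [Su Sv uv ->]]]; rewrite ler_pdivlMr ?mdist_gt0//.
  by have /andP[] := h u v Su Sv.
have [C1 [r r0 rC]] := fC.
have hQ : has_inf Q by split; [exists q0|exists r; exact: lbQ _ _ rC].
have rQ : r <= inf Q by apply: lb_le_inf; [case: hQ|exact: lbQ _ _ rC].
have Q_gt0 : 0 < inf Q by exact: lt_le_trans rQ.
exists (inf Q) => // u v Su Sv; have [->|uv] := eqVneq u v.
  by rewrite mdistxx subrr normr0 !mulr0 lexx.
have d0 : 0 < mdist u v by rewrite mdist_gt0.
apply/andP; split.
  rewrite -ler_pdivlMr//; apply: ge_inf; first by case: hQ.
  by exists u, v.
rewrite -ler_pdivrMr// -ler_pdivrMl//; apply: lb_le_inf.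
  by case: hE.
move=> D [D1 [s s0 sD]]; rewrite ler_pdivrMl// ler_pdivrMr//.
have /andP[_ /le_trans] := sD u v Su Sv; apply.
rewrite ler_wpM2r ?(ltW d0)// ler_wpM2r//; first exact: le_trans D1.
by apply: lb_le_inf; [case: hQ|exact: lbQ _ _ sD].
Qed.

(** Translate and rescale by 1/r. Extension by 0 outside [S] lets the bound C d(o, u) on the norm
    hold at every point of [A]. *)
Lemma embeds_based S C (o : A) : S o -> embeds_with_distortion_le X S C ->
  exists f : A -> X, [/\ f o = 0, forall u, ~ S u -> f u = 0 &
    forall u v, S u -> S v -> mdist u v <= `|f u - f v| <= C * mdist u v].
Proof.
move=> So [f [D [[D1 [r r0 rD]] _] DC]].
exists (fun u => if u \in S then r^-1 *: (f u - f o) else 0); split.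
- by rewrite mem_set// subrr scaler0.
- by move=> u Su; rewrite memNset.
- move=> u v Su Sv; rewrite !mem_set// -scalerBr opprB addrA subrK normrZ.
  rewrite ger0_norm ?invr_ge0 ?(ltW r0)// ler_pdivlMl// ler_pdivrMl// mulrA.
  have /andP[-> /le_trans->//] := rD u v Su Sv.
  by rewrite ler_wpM2r ?mdist_ge0// ler_wpM2l// (ltW r0).
Qed.

End distortion.

(** * Gluing the embeddings of balls *)

Section gluing.
Context {R : realType} {p : R} {p1 : 1 <= p} {A : metricType R}.
Variables (C : R) (o : A) (eps : R).
Hypotheses (C1 : 1 <= C) (A_lf : locally_finite_metric A) (eps0 : 0 < eps).
Hypothesis fin_embeds : forall S : set A, finite_set S ->
  embeds_with_distortion_le (lp p1) S C.

Let C0 : 0 <= C. Proof. exact: le_trans C1. Qed.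

Lemma glued_embedding : exists F : A -> lp p1, forall u v,
  (1 - C * eps) * mdist u v <= `|F u - F v| <= C * (1 + eps) * mdist u v.
Proof.
have [sigma sigmaP] := nat_pairing.
have [c [rho [rho0 c1 c_supp c_slow]]] := @slow_unit_path R p p1 eps eps0.
have /choice[f fP] i := embeds_based _ _ o (ballxx o (rho0 i))
  (fin_embeds _ (A_lf o (rho i))).
have f_le i u : `|f i u| <= C * mdist o u.
  have [fo f0 fi] := fP i.
  have [Su|/f0->] := pselect (ball o (rho i) u); last first.
    by rewrite normr0 mulr_ge0// mdist_ge0.
  have /andP[_] := fi u o Su (ballxx o (rho0 i)).
  by rewrite fo subr0 metric_sym.
exists (fun u => glue sigma (c (mdist o u)) (f^~ u)) => u v.
(* The slowness of [c] is weighted by the smaller radius, so [v], whose images remain in the second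
   term, must be the point closer to [o]. *)
wlog vu : u v / mdist o v <= mdist o u.
  move=> h; have [/h//|/ltW/h] := lerP (mdist o v) (mdist o u).
  by rewrite distrC metric_sym.
pose K := C * mdist o u; pose t := mdist o u; pose s := mdist o v.
have uK i : `|f i u| <= K by exact: f_le.
have vK i : `|f i v| <= K by rewrite (le_trans (f_le _ _))// ler_wpM2l.
have uvK i : `|f i u - f i v| <= K + K.
  by rewrite (le_trans (ler_normB _ _))// lerD.
rewrite (glueB _ sigmaP _ _ _ _ _ uK vK).
(* A nonzero weight at t = d(o, u) forces t < [rho i], and then [v], being closer to [o], lies in
   the ball as well. *)
have in_ball i : c t i != 0 ->
    mdist u v <= `|f i u - f i v| <= C * mdist u v.
  move=> /c_supp -/(_ (mdist_ge0 _ _)) tr; have [_ _] := fP i.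
  by apply; rewrite ballEmdist//=; exact: le_lt_trans tr.
have G1 : `|glue sigma (c t) (fun i => f i u - f i v)| <= C * mdist u v.
  rewrite -[leRHS]mulr1 -(c1 t); apply: (norm_glue_le _ sigmaP _ _ _ _ uvK).
    by rewrite mulr_ge0// mdist_ge0.
  by move=> i /in_ball /andP[].
have G2 : mdist u v <= `|glue sigma (c t) (fun i => f i u - f i v)|.
  rewrite -[leLHS]mulr1 -(c1 t); apply: (norm_glue_ge _ sigmaP _ _ _ _ uvK).
    exact: mdist_ge0.
  by move=> i /in_ball /andP[].
(* The images of [v] have norm at most C s; then s |c(t) - c(s)| <= eps (t - s), and t - s <= d(u,
   v). *)
have G3 : `|glue sigma (c t - c s) (f^~ v)| <= C * eps * mdist u v.
  apply: (@le_trans _ _ (C * s * `|c t - c s|)).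
    apply: (norm_glue_le _ sigmaP _ _ _ _ vK) => [|i _]; last exact: f_le.
    by rewrite mulr_ge0// mdist_ge0.
  rewrite -!mulrA ler_wpM2l//.
  rewrite (le_trans (c_slow _ _ (mdist_ge0 _ _) vu))// ler_wpM2l ?(ltW eps0)//.
  by rewrite lerBlDr addrC (metric_sym u) metric_triangle.
apply/andP; split.
  by rewrite (le_trans _ (lerB_normD _ _))//; move: G2 G3; lra.
by rewrite (le_trans (ler_normD _ _))//; move: G1 G3; lra.
Qed.

End gluing.

(** * Choice of the parameter and conclusion *)

Lemma D_le_lp (R : realType) (p : R) (p1 : 1 <= p) (e : R) : 0 < e ->
  D_le (lp p1) (1 + e).
Proof.
move=> e0 C A C1 A_lf fin_embeds.
have CeC : 1 <= (1 + e) * C.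
  by rewrite (le_trans C1)// ler_peMl ?lerDl ?(le_trans _ C1)// ltW.
have [[x0]|A0] := pselect (inhabited A); last first.
  apply: (@bilipschitz_embeds _ _ _ _ (fun=> 0)); split=> //.
  by exists 1 => // u; exfalso; apply: A0.
have C0 : 0 < C by exact: lt_le_trans C1.
have q0 : 0 < (1 + e) * C + 1 by lra.
(* The solution of 1 + eps = (1 + e)(1 - C eps), which makes the ratio of the two glued bounds
   exactly (1 + e) C. *)
pose eps := e / ((1 + e) * C + 1).
have eps0 : 0 < eps by rewrite divr_gt0.
have epsE : eps * ((1 + e) * C + 1) = e by rewrite divfK// gt_eqF.
have eC1 : 0 < 1 - C * eps.
  rewrite subr_gt0 /eps mulrA ltr_pdivrMr// mul1r; nra.
have [F FP] := glued_embedding C x0 eps C1 A_lf eps0 fin_embeds.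
apply: (@bilipschitz_embeds _ _ _ _ F); split=> //.
exists (1 - C * eps) => // u v _ _; have /andP[-> /le_trans->//] := FP u v.
rewrite ler_wpM2r ?mdist_ge0//.
have -> : (1 - C * eps) * ((1 + e) * C) = C * (1 + e - eps * ((1 + e) * C)).
  by ring.
rewrite ler_wpM2l ?(ltW C0)//; move: epsE; rewrite mulrDr mulr1; lra.
Qed.

Theorem corollary1p10 (R : realType) (p : R) (p1 : 1 <= p) :
  D_le_plus (lp p1) 1.
Proof.
have [D1|ND1] := pselect (D_le (lp p1) 1); first by right.
by left; split=> // e; exact: D_le_lp.
Qed.
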